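(* Let $(R,\mathfrak{m},k)$ be a $3$-dimensional Cohen-Macaulay noetherian local ring of characteristic $2$. Let $G$ be a group of order $2$ acting wildly on $R$, and let $\mathfrak{n}$ be the maximal ideal of the local ring $R^G$. Then $(R^G,\mathfrak{n})$ is Buchsbaum if and only if $\mathrm{im}(\mathrm{tr}:R\to R^G)=\mathfrak{n}$.
   Context: $G$ acts wildly on $R$ if: (i) $G$ acts trivially on the residue field $k$; (ii) $G$ acts freely on the punctured spectrum $\mathrm{Spec}(R)\setminus\{\mathfrak{m}\}$, i.e. for every prime $P\neq\mathfrak{m}$ the inertia group $\{g\in G: g(a)-a\in P\text{ for all }a\in R\}$ is trivial (so that $R^G\to R$ is étale away from the closed point); (iii) $R^G$ is noetherian and $R$ is a finite $R^G$-module. Under these hypotheses $R^G$ is local. The transfer is $\mathrm{tr}(a)=\sum_{g\in G}g(a)$. In a noetherian local ring $(A,\mathfrak{n})$, a sequence $x_1,\dots,x_r\in\mathfrak{n}$ is a weak sequence if $\mathfrak{n}\,((x_1,\dots,x_{i-1}):x_i)\subseteq(x_1,\dots,x_{i-1})$ for all $i$; $A$ is Buchsbaum if every system of parameters is a weak sequence. *)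

(* Defs.v *)
From HB Require Import structures.
From mathcomp Require Import all_boot all_order all_algebra all_fingroup.
From mathcomp Require Import boolp classical_sets.

Set Implicit Arguments.
Unset Strict Implicit.
Unset Printing Implicit Defensive.

Import GRing.Theory.
Local Open Scope ring_scope.
Local Open Scope classical_set_scope.

Section Ideals.
Variable A : comNzRingType.
Implicit Types (I J m : set A) (s : seq A).

(* The unit ideal is allowed, unlike for the idealr_closed of ring_quotient,
   which is restricted to proper ideals and to boolean predicates. *)
Definition is_ideal I :=
  [/\ I 0, (forall a b, I a -> I b -> I (a + b)) & (forall a b, I b -> I (a * b))].

Definition prime_ideal (P : set A) :=
  [/\ is_ideal P, ~ P 1 & forall a b, P (a * b) -> P a \/ P b].

Definition maximal_ideal m :=
  [/\ is_ideal m, ~ m 1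
    & forall I, is_ideal I -> ~ I 1 -> m `<=` I -> I = m].

Definition ideal_gen s : set A :=
  [set a | exists c : nat -> A, a = \sum_(i < size s) c i * s`_i].

Definition ideal_prod I J : set A :=
  [set a | exists2 t : seq (A * A),
    {in t, forall p, I p.1 /\ J p.2} & a = \sum_(p <- t) p.1 * p.2].

Definition colon_ideal I (x : A) : set A := [set a | I (a * x)].

Definition radical I : set A := [set a | exists n : nat, I (a ^+ n)].

Definition noetherian :=
  forall I, is_ideal I -> exists s, I = ideal_gen s.

Definition local_ring m :=
  maximal_ideal m /\ forall m', maximal_ideal m' -> m' = m.

Definition noetherian_local m := noetherian /\ local_ring m.

Definition prime_chain (n : nat) (P : nat -> set A) :=
  (forall i, (i <= n)%N -> prime_ideal (P i)) /\
  (forall i, (i < n)%N -> P i `<` P i.+1).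

Definition krull_dim (d : nat) :=
  (exists P : nat -> set A, prime_chain d P) /\
  (forall n (P : nat -> set A), prime_chain n P -> (n <= d)%N).

Definition regular_seq s :=
  (forall i, (i < size s)%N ->
     forall a, ideal_gen (take i s) (a * s`_i) -> ideal_gen (take i s) a) /\
  ~ ideal_gen s 1.

Definition depth m (d : nat) :=
  (exists s, [/\ size s = d, {in s, forall x, m x} & regular_seq s]) /\
  (forall s, {in s, forall x, m x} -> regular_seq s -> (size s <= d)%N).

Definition cohen_macaulay m :=
  noetherian_local m /\ exists d, krull_dim d /\ depth m d.

Definition system_of_parameters m s :=
  [/\ krull_dim (size s), {in s, forall x, m x} & radical (ideal_gen s) = m].

Definition weak_sequence m s :=
  {in s, forall x, m x} /\
  forall i, (i < size s)%N ->
    ideal_prod m (colon_ideal (ideal_gen (take i s)) s`_i)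
      `<=` ideal_gen (take i s).

Definition buchsbaum m :=
  noetherian_local m /\
  forall s, system_of_parameters m s -> weak_sequence m s.

End Ideals.

Arguments noetherian A : clear implicits.
Arguments krull_dim A d : clear implicits.

(* Following the library, [to a g] is the image of [a] under [g], and the
   axiom is [to a (g * h) = to (to a g) h]; a left action is turned into such
   an action by inverting group elements. *)
Record ring_action (gT : finGroupType) (R : comNzRingType) := RingAction {
  ring_act :> {action gT &-> R};
  ring_act_zmod : forall g, zmod_morphism (ring_act^~ g);
  ring_act_monoid : forall g, GRing.monoid_morphism (ring_act^~ g)
}.

Section Invariants.
Variables (gT : finGroupType) (R : comNzRingType) (to : ring_action gT R).

Definition fixed : {pred R} := [pred a | [forall g : gT, to a g == a]].

Lemma fixedP a : reflect (forall g, to a g = a) (a \in fixed).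
Proof. exact: 'forall_eqP. Qed.

Lemma fixed_subring : subring_closed fixed.
Proof.
split; first by apply/fixedP => g; have [] := ring_act_monoid to g.
- move=> a b /fixedP fa /fixedP fb; apply/fixedP => g.
  by rewrite (ring_act_zmod to g) fa fb.
- move=> a b /fixedP fa /fixedP fb; apply/fixedP => g.
  by have [_ ->] := ring_act_monoid to g; rewrite fa fb.
Qed.

HB.instance Definition _ := GRing.isSubringClosed.Build R fixed fixed_subring.

Record fixring := Fixring { fixval :> R; fixvalP : fixval \in fixed }.

HB.instance Definition _ := [isSub for fixval].
HB.instance Definition _ := [Choice of fixring by <:].
HB.instance Definition _ := [SubChoice_isSubComNzRing of fixring by <:].

Lemma ring_actM a g h : to a (g * h)%g = to (to a g) h.
Proof. by case: (ring_act to) => f [_ fM] /=; rewrite fM ?finset.in_setT. Qed.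

Lemma ring_act_sum g (I : Type) (r : seq I) (F : I -> R) :
  to (\sum_(i <- r) F i) g = \sum_(i <- r) to (F i) g.
Proof.
have toB a b : to (a - b) g = to a g - to b g by exact: ring_act_zmod.
have to0 : to 0 g = 0 by have := toB 0 0; rewrite !subrr.
have toN a : to (- a) g = - to a g by rewrite -[- a]sub0r toB to0 sub0r.
have toD a b : to (a + b) g = to a g + to b g.
  by rewrite -{1}[b]opprK toB toN opprK.
exact: (big_morph (fun a => to a g) toD to0).
Qed.

Lemma transfer_fixed a : \sum_(g : gT) to a g \in fixed.
Proof.
apply/fixedP => h; rewrite ring_act_sum [RHS](reindex_inj (mulIg h)) /=.
by apply: eq_bigr => g _; rewrite ring_actM.
Qed.

Definition transfer (a : R) : fixring := Fixring (transfer_fixed a).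

Definition inertia (P : set R) : set gT :=
  [set g | forall a, P (to a g - a)].

Definition finite_over_fixring :=
  exists s : seq R, forall a : R,
    exists c : nat -> fixring, a = \sum_(i < size s) fixval (c i) * s`_i.

(* [inertia m = [set: gT]] says that the induced action on the residue field
   of [m] is trivial. *)
Definition acts_wildly (m : set R) :=
  [/\ inertia m = [set: gT],
      (forall P : set R, prime_ideal P -> P <> m -> inertia P = [set 1%g]),
      noetherian fixring
    & finite_over_fixring].

End Invariants.

(* Main.v *)
Require Import Defs.
From mathcomp Require Import all_boot all_order all_algebra all_fingroup.
From mathcomp Require Import boolp classical_sets.
From mathcomp Require Import ring.

(* Let [A = R^G], [s] the involution and [tr = 1 + s]; in characteristic 2 the
   kernel of [tr] on [R] is [A]. Every system of parameters x, y, z of [A] is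
   regular on [R], because [R] is Cohen-Macaulay. If a in [A] satisfies
   a z in (x, y)A, then a = r x + u y in [R], and applying [tr] gives
   tr u = t x and tr r = - t y with t in [A]; the class of t modulo [tr R]
   vanishes iff a lies in (x, y)A. Hence ((x, y) : z) / (x, y) embeds in
   [A / tr R] and is killed by the maximal ideal n as soon as tr R = n.
   Conversely, freeness on the punctured spectrum makes [tr R] n-primary, so x,
   y, z can be chosen in [tr R]; then a = y' x - x' y, where tr x' = x and
   tr y' = y, realizes the class of 1, and n kills 1 modulo [tr R] if [A] is
   Buchsbaum.

   The regularity of x, y, z is read off the Koszul complex: (x, y, z)R is
   m-primary, so the given regular sequence f1, f2, f3 lies in its radical,
   which forces the first Koszul homology to vanish, and Nakayama's lemma then
   gives regularity. That dim A = 3 follows from going up and incomparability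
   for the quadratic integral extension [A -> R]. *)

Set Implicit Arguments.
Unset Strict Implicit.
Unset Printing Implicit Defensive.

Import GRing.Theory.

(** * Ideals and primes of noetherian rings *)

Section CommutativeAlgebra.
Local Open Scope ring_scope.
Local Open Scope classical_set_scope.

Variable A : comNzRingType.
Implicit Types (I J K P Q m : set A) (s : seq A) (a b c x y z : A).

Lemma ideal0 I : is_ideal I -> I 0. Proof. by case. Qed.

Lemma idealD I a b : is_ideal I -> I a -> I b -> I (a + b).
Proof. by case=> _ + _; apply. Qed.

Lemma idealMl I a b : is_ideal I -> I b -> I (a * b).
Proof. by case=> _ _; apply. Qed.

Lemma idealMr I a b : is_ideal I -> I a -> I (a * b).
Proof. by rewrite mulrC; exact: idealMl. Qed.

Lemma idealN I a : is_ideal I -> I a -> I (- a).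
Proof. by rewrite -mulN1r; exact: idealMl. Qed.

Lemma idealB I a b : is_ideal I -> I a -> I b -> I (a - b).
Proof. by move=> idI Ia Ib; apply: idealD => //; apply: idealN. Qed.

Lemma ideal_sum I (T : Type) (r : seq T) (p : pred T) (F : T -> A) :
  is_ideal I -> (forall i, p i -> I (F i)) -> I (\sum_(i <- r | p i) F i).
Proof.
by move=> idI IF; apply: big_ind => //; [exact: ideal0 | move=> a b; exact: idealD].
Qed.

Lemma prime_idealX P a k : prime_ideal P -> P (a ^+ k) -> P a.
Proof.
case=> _ P1 PM; elim: k => [|k IHk]; first by rewrite expr0 => /P1.
by rewrite exprS => /PM [].
Qed.

Lemma ideal_gen_nil : ideal_gen [::] = [set (0 : A)].
Proof.
apply/seteqP; split => a; first by case=> c ->; rewrite big_ord0.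
by move=> ->; exists (fun=> 0); rewrite big_ord0.
Qed.

(** The ideal [I + (a)], written as a congruence modulo [I]. *)
Definition ideal_adjoin I a : set A := [set b | exists c, I (b - c * a)].

Lemma ideal_gen_cons x s :
  ideal_gen (x :: s) = ideal_adjoin (ideal_gen s) x.
Proof.
apply/seteqP; split => a.
  case=> c ->; exists (c 0%N); exists (fun i => c i.+1).
  by rewrite big_ord_recl /= addrC addKr.
case=> c [d /eqP]; rewrite subr_eq addrC => /eqP ->.
by exists (fun i => if i is j.+1 then d j else c); rewrite big_ord_recl.
Qed.

Lemma ideal_gen_is_ideal s : is_ideal (ideal_gen s).
Proof.
split.
- by exists (fun=> 0); rewrite big1 // => i _; rewrite mul0r.
- move=> _ _ [c ->] [d ->]; exists (fun i => c i + d i).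
  by rewrite -big_split /=; apply: eq_bigr => i _; rewrite mulrDl.
- move=> a _ [c ->]; exists (fun i => a * c i).
  by rewrite big_distrr /=; apply: eq_bigr => i _; rewrite mulrA.
Qed.

Lemma ideal_gen_sub I s :
  is_ideal I -> {in s, forall x, I x} -> ideal_gen s `<=` I.
Proof.
move=> idI sI _ [c ->]; apply: ideal_sum => // i _.
by apply: idealMl => //; apply: sI; rewrite mem_nth.
Qed.

Lemma mem_ideal_gen s : {in s, forall x, ideal_gen s x}.
Proof.
elim: s => // x s IHs y; rewrite inE ideal_gen_cons => /predU1P [->|/IHs sy].
  by exists 1; rewrite mul1r subrr; exact: (ideal0 (ideal_gen_is_ideal s)).
by exists 0; rewrite mul0r subr0.
Qed.

Lemma ideal_gen1 x a : ideal_gen [:: x] a <-> exists b, a = b * x.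
Proof.
rewrite ideal_gen_cons ideal_gen_nil.
by split=> -[b /= /eqP]; rewrite ?subr_eq0 => /eqP ->; exists b; rewrite ?subrr.
Qed.

Lemma ideal_gen2 x y a :
  ideal_gen [:: x; y] a <-> exists b c, a = b * x + c * y.
Proof.
rewrite ideal_gen_cons /=; split=> [[b /ideal_gen1 [c /eqP]]|[b [c ->]]].
  by rewrite subr_eq addrC => /eqP ->; exists b, c.
by exists b; apply/ideal_gen1; exists c; ring.
Qed.

Lemma ideal_gen3 x y z a :
  ideal_gen [:: x; y; z] a <-> exists b c d, a = b * x + c * y + d * z.
Proof.
rewrite ideal_gen_cons /=; split=> [[b /ideal_gen2 [c [d /eqP]]]|[b [c [d ->]]]].
  by rewrite subr_eq => /eqP ->; exists b, c, d; ring.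
by exists b; apply/ideal_gen2; exists c, d; ring.
Qed.

Lemma ideal_adjoin_is_ideal I a : is_ideal I -> is_ideal (ideal_adjoin I a).
Proof.
move=> idI; split.
- by exists 0; rewrite mul0r subrr; exact: ideal0.
- move=> b c [d Id] [e Ie]; exists (d + e).
  rewrite (_ : _ - _ = (b - d * a) + (c - e * a)); last by ring.
  exact: idealD.
- move=> b c [d Id]; exists (b * d).
  rewrite (_ : _ - _ = b * (c - d * a)); last by ring.
  exact: idealMl.
Qed.

Lemma sub_ideal_adjoin I a : is_ideal I -> I `<=` ideal_adjoin I a.
Proof. by move=> idI b Ib; exists 0; rewrite mul0r subr0. Qed.

Lemma ideal_adjoin_self I a : is_ideal I -> ideal_adjoin I a a.
Proof. by move=> idI; exists 1; rewrite mul1r subrr; exact: ideal0. Qed.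

Lemma colon_is_ideal I x : is_ideal I -> is_ideal (colon_ideal I x).
Proof.
move=> idI; rewrite /colon_ideal; split => /=.
- by rewrite mul0r; exact: ideal0.
- by move=> a b; rewrite mulrDl; exact: idealD.
- by move=> a b; rewrite -mulrA; exact: idealMl.
Qed.

Lemma maximal_ideal_prime m : maximal_ideal m -> prime_ideal m.
Proof.
case=> idm m1 maxm; split=> // a b mab.
apply: contrapT => /not_orP [ma mb].
have unit_mod c : ~ m c -> ideal_adjoin m c 1.
  move=> mc; apply: contrapT => m1'; apply: mc.
  rewrite -(maxm _ (ideal_adjoin_is_ideal c idm) m1' (sub_ideal_adjoin c idm)).
  exact: ideal_adjoin_self.
have [[d md] [e me]] := (unit_mod a ma, unit_mod b mb); apply: m1.
have -> : 1 = (1 - d * a) + (d * a) * (1 - e * b) + d * e * (a * b) by ring.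
by apply: idealD => //; [apply: idealD|] => //; apply: idealMl.
Qed.

(** * Noetherian rings: maximal members of families, primes, Nakayama's lemma *)

Section Noetherian.
Hypothesis noethA : noetherian A.

(** Zorn's lemma applies because the union of a chain is finitely generated, hence equal to a
    member. The empty set is added to [S] to bound chains without a member in [S]. *)
Lemma noetherian_max_ideal (S : set (set A)) :
  S `<=` @is_ideal A -> S !=set0 ->
  exists2 I, S I & forall J, S J -> I `<=` J -> J = I.
Proof.
move=> idS [I0 SI0].
have [F FS totF|I [[I_eq0|SI] maxI]] :=
    @Zorn_bigcup A (fun I => I = set0 \/ S I).
- case: (pselect (exists2 X, F X & S X)) => [[X FX SX]|noX]; last first.
    left; apply/seteqP; split=> // a [X FX Xa].
    by have [X0|SX] := FS _ FX; [rewrite X0 in Xa | case: noX; exists X].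
  set U := \bigcup_(X in F) X.
  have idF Y a : F Y -> Y a -> is_ideal Y.
    by move=> FY Ya; case: (FS _ FY) => [Y0|/idS //]; rewrite Y0 in Ya.
  have idU : is_ideal U.
    split; first by exists X => //; apply: ideal0; apply: idS.
      move=> a b [Y FY Ya] [Z FZ Zb]; have [YZ|ZY] := totF _ _ FY FZ.
        by exists Z => //; apply: idealD => //; [exact: idF Zb | exact: YZ].
      by exists Y => //; apply: idealD => //; [exact: idF Ya | exact: ZY].
    by move=> a b [Y FY Yb]; exists Y => //; apply: idealMl => //; exact: idF Yb.
  have [s U_s] := noethA idU.
  have [Y FY [SY sY]] : exists2 Y, F Y & S Y /\ {in s, forall x, Y x}.
    have : {in s, forall x, U x} by rewrite U_s; exact: mem_ideal_gen.
    elim: s {U_s} => [|x s IHs] sU; first by exists X.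
    have [Y FY [SY sY]] := IHs (fun y ys => sU y (mem_behead (s := x :: s) ys)).
    have [Z FZ Zx] := sU x (mem_head x s).
    have [YZ|ZY] := totF _ _ FY FZ.
      exists Z => //; split; first by case: (FS _ FZ) => // Z0; rewrite Z0 in Zx.
      by move=> y; rewrite inE => /predU1P [->//|/sY /YZ].
    exists Y => //; split=> // y; rewrite inE => /predU1P [->|/sY //].
    exact: ZY.
  right; suff -> : U = Y by [].
  apply/seteqP; split=> [|a Ya]; last by exists Y.
  by rewrite U_s; apply: ideal_gen_sub => //; exact: idS.
- exfalso; apply: (maxI I0); last by right.
  rewrite I_eq0; split; first exact: sub0set.
  by move=> /(_ 0 (ideal0 (idS _ SI0))).
- exists I => // J SJ IJ; apply: contrapT => neqIJ.
  apply: (maxI J); last by right.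
  by split=> // JI; apply: neqIJ; apply/seteqP.
Qed.

(** An ideal maximal among those containing [I] and missing [S] is prime: adjoining [a] or [b]
    outside it meets [S], and the product of the two elements met would lie in it if [a * b] did. *)
Lemma prime_avoiding (S I : set A) :
  S 1 -> (forall a b, S a -> S b -> S (a * b)) -> is_ideal I ->
  (forall a, S a -> ~ I a) ->
  exists P, [/\ prime_ideal P, I `<=` P & forall a, S a -> ~ P a].
Proof.
move=> S1 SM idI IS.
have [||J [idJ IJ JS] maxJ] := @noetherian_max_ideal
  [set J | [/\ is_ideal J, I `<=` J & forall a, S a -> ~ J a]].
- by move=> J [].
- by exists I; split.
exists J; split=> //; split=> // [|a b Jab]; first exact: JS.
apply: contrapT => /not_orP [Ja Jb].
have meetS c : ~ J c -> exists2 d, S d & ideal_adjoin J c d.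
  move=> Jc; apply: contrapT => noS; apply: Jc.
  rewrite -(maxJ (ideal_adjoin J c)); first exact: ideal_adjoin_self.
    split; first exact: ideal_adjoin_is_ideal.
      by move=> x /IJ; exact: sub_ideal_adjoin.
    by move=> x Sx Jx; apply: noS; exists x.
  exact: sub_ideal_adjoin.
have [s Ss [c Jc]] := meetS a Ja.
have [t St [d Jd]] := meetS b Jb.
apply: (JS (s * t)); first exact: SM.
have -> : s * t = (s - c * a) * t + c * a * (t - d * b) + c * d * (a * b) by ring.
by apply: idealD => //; [apply: idealD|] => //; [apply: idealMr| |];
  rewrite //; apply: idealMl.
Qed.

Lemma radical_prime I a :
  is_ideal I -> (forall P, prime_ideal P -> I `<=` P -> P a) -> radical I a.
Proof.
move=> idI Pa; apply: contrapT => Ia.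
have [||||P [prP IP aP]] := @prime_avoiding [set a ^+ k | k in setT] I.
- by exists 0%N.
- by move=> _ _ [k _ <-] [l _ <-]; exists (k + l)%N => //; rewrite exprD.
- exact: idI.
- by move=> _ [k _ <-] Iak; apply: Ia; exists k.
by apply: (aP a); [exists 1%N | exact: Pa].
Qed.

(** Noetherian induction: a maximal counterexample [J] is not prime, and the lists for [J + (a)] and
    [J + (b)], with [a * b] in [J], concatenate to one for [J]. *)
Lemma primes_over_finite I : is_ideal I ->
  exists L : seq (set A), (forall P, List.In P L -> prime_ideal P /\ I `<=` P) /\
    forall P, prime_ideal P -> I `<=` P -> exists2 Q, List.In Q L & Q `<=` P.
Proof.
move=> idI; apply: contrapT => noL.
have [||J [idJ noLJ] maxJ] := @noetherian_max_ideal [set I | is_ideal I /\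
  ~ exists L : seq (set A), (forall P, List.In P L -> prime_ideal P /\ I `<=` P) /\
    forall P, prime_ideal P -> I `<=` P -> exists2 Q, List.In Q L & Q `<=` P].
- by move=> J [].
- by exists I; split.
have J1 : ~ J 1.
  move=> J1; apply: noLJ; exists [::]; split=> // P [_ P1 _] JP.
  by case: P1; exact: JP.
have [prJ|] := pselect (prime_ideal J).
  apply: noLJ; exists [:: J]; split=> [P [<-|//]|P _ JP]; first by split.
  by exists J => //; left.
move=> nprJ; apply: nprJ; split=> // a b Jab; apply: contrapT => /not_orP [Ja Jb].
have listP c : ~ J c -> exists L : seq (set A),
    (forall P, List.In P L -> prime_ideal P /\ ideal_adjoin J c `<=` P) /\
    forall P, prime_ideal P -> ideal_adjoin J c `<=` P ->
      exists2 Q, List.In Q L & Q `<=` P.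
  move=> Jc; apply: contrapT => noLc; apply: Jc.
  rewrite -(maxJ (ideal_adjoin J c)); first exact: ideal_adjoin_self.
    by split=> //; exact: ideal_adjoin_is_ideal.
  exact: sub_ideal_adjoin.
have [La [LaP La_dom]] := listP a Ja.
have [Lb [LbP Lb_dom]] := listP b Jb.
have adjoin_sub P c : is_ideal P -> J `<=` P -> P c -> ideal_adjoin J c `<=` P.
  move=> idP JP Pc d [e /JP Pde].
  by rewrite -(subrK (e * c) d); apply: idealD => //; apply: idealMl.
apply: noLJ; exists (La ++ Lb)%list; split=> [P|P prP JP].
  by move=> /(@List.in_app_or _ _ _ _) [/LaP|/LbP] [prP sP]; split=> // c Jc;
    apply: sP; exact: sub_ideal_adjoin.
have [idP _ PM] := prP; have [Pa|Pb] := PM _ _ (JP _ Jab).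
  have [Q QL QP] := La_dom P prP (adjoin_sub P a idP JP Pa).
  by exists Q => //; apply: List.in_or_app; left.
have [Q QL QP] := Lb_dom P prP (adjoin_sub P b idP JP Pb).
by exists Q => //; apply: List.in_or_app; right.
Qed.

(** An ideal maximal among the proper ones containing a non-unit [a] is a maximal ideal, hence equal
    to [m]. *)
Lemma local_unit m a : local_ring m -> ~ m a -> exists b, b * a = 1.
Proof.
move=> [_ uniq_m] ma; apply: contrapT => noinv; apply: ma.
have [||J [idJ J1 Ja] maxJ] :=
    @noetherian_max_ideal [set J | [/\ is_ideal J, ~ J 1 & J a]].
- by move=> J [].
- exists (ideal_gen [:: a]); split; first exact: ideal_gen_is_ideal.
    by case/ideal_gen1 => b ab1; apply: noinv; exists b.
  by apply/ideal_gen1; exists 1; rewrite mul1r.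
rewrite -(uniq_m J) //; split=> // I idI I1 JI; apply: maxJ => //.
by split=> //; exact: JI.
Qed.

(* With [J] maximal among the ideals containing [K] but not [C], and [a] in
   [C] but not in [J], we get [C <= J + (a)], so [a] lies in [m a + J]. *)
Lemma nakayama (m C K : set A) :
  local_ring m -> is_ideal C -> is_ideal K ->
  (forall c, C c -> exists2 b, ideal_prod m C b & K (c - b)) -> C `<=` K.
Proof.
move=> locm idC idK CmCK; apply: contrapT => CK.
have [||J [idJ KJ CJ] maxJ] :=
    @noetherian_max_ideal [set J | [/\ is_ideal J, K `<=` J & ~ C `<=` J]].
- by move=> J [].
- by exists K; split.
have [a Ca Ja] : exists2 a, C a & ~ J a.
  apply: contrapT => noa; apply: CJ => c Cc; apply: contrapT => Jc.
  by apply: noa; exists c.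
have CJa : C `<=` ideal_adjoin J a.
  apply: contrapT => CJa; apply: Ja.
  rewrite -(maxJ (ideal_adjoin J a)); first exact: ideal_adjoin_self.
    split=> //; first exact: ideal_adjoin_is_ideal.
    by move=> x /KJ; exact: sub_ideal_adjoin.
  exact: sub_ideal_adjoin.
have [[idm m1 _] _] := locm.
have [_ [t tP ->] Kab] := CmCK a Ca.
have [mu m_mu Jmu] : exists2 mu, m mu & J (\sum_(p <- t) p.1 * p.2 - mu * a).
  elim: t tP {Kab} => [|p t IHt] tP.
    by exists 0; [exact: ideal0 | rewrite big_nil mul0r subrr; exact: ideal0].
  have [mu m_mu Jmu] := IHt (fun q qt => tP q (mem_behead (s := p :: t) qt)).
  have [mp Cp] := tP p (mem_head p t); have [d Jd] := CJa _ Cp.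
  exists (p.1 * d + mu); first by apply: idealD => //; exact: idealMr.
  rewrite big_cons; move: (\sum_(q <- t) _) Jmu => u Jmu.
  have -> : p.1 * p.2 + u - (p.1 * d + mu) * a =
    p.1 * (p.2 - d * a) + (u - mu * a) by ring.
  by apply: idealD => //; exact: idealMl.
have [|u u1] := @local_unit m (1 - mu) locm.
  by move=> m1mu; apply: m1; rewrite -(subrK mu 1); exact: idealD.
apply: Ja; rewrite -(mul1r a) -u1 -mulrA; apply: idealMl => //.
move: (\sum_(p <- t) _) Kab Jmu => b Kab Jmu.
have -> : (1 - mu) * a = (a - b) + (b - mu * a) by ring.
by apply: idealD => //; exact: KJ.
Qed.

End Noetherian.

(* Recursion only on the primes not contained in [P]: an element outside [P]
   avoids the other ones automatically. *)
Lemma prime_avoidance I (L : seq (set A)) :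
  is_ideal I -> (forall P, List.In P L -> prime_ideal P /\ ~ I `<=` P) ->
  exists2 x, I x & forall P, List.In P L -> ~ P x.
Proof.
move=> idI; have [k] := ubnP (size L); elim: k L => // k IHk [|P L] ltLk LP.
  by exists 0 => //; exact: ideal0.
have [[idP P1 PM] IP] := LP P (or_introl erefl).
pose L' := [seq Q <- L | ~~ `[< Q `<=` P >]].
have L'E Q : List.In Q L' <-> List.In Q L /\ ~ Q `<=` P.
  by rewrite /L' List.filter_In; split=> -[QL /asboolPn QP].
have [|Q /L'E [QL _]|x Ix xL'] := IHk L'.
- by rewrite size_filter (leq_ltn_trans (count_size _ _)).
- by apply: LP; right.
suff [y Iy [Py yL']] : exists2 y, I y & ~ P y /\ forall Q, List.In Q L' -> ~ Q y.
  exists y => // Q [<-//|QL] Qy; have [QP|QP] := pselect (Q `<=` P).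
    by apply: Py; exact: QP.
  by apply: (yL' Q) => //; apply/L'E.
have [Px|Px] := pselect (P x); last by exists x.
(* As [P] is prime, [y] can be a product of an element of [I] and one of each ideal in [L'], all
   outside [P]; then [x + y] avoids [P] and all of [L']. *)
have [y Iy [Py yL']] : exists2 y, I y & ~ P y /\ forall Q, List.In Q L' -> Q y.
  have : forall Q, List.In Q L' -> is_ideal Q /\ ~ Q `<=` P.
    by move=> Q /L'E [QL QP]; split=> //; have [[]] := LP Q (or_intror QL).
  elim: {xL' L'E} L' => [_|Q M IHM MP].
    apply: contrapT => noy; apply: IP => y Iy; apply: contrapT => Py.
    by apply: noy; exists y.
  have [y Iy [Py yM]] := IHM (fun Q QM => MP Q (or_intror QM)).
  have [idQ QP] := MP Q (or_introl erefl).
  have [q Qq Pq] : exists2 q, Q q & ~ P q.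
    apply: contrapT => noq; apply: QP => q Qq; apply: contrapT => Pq.
    by apply: noq; exists q.
  exists (q * y); first exact: idealMl.
  split; first by move=> /PM [].
  move=> Q' [<-|Q'M]; first exact: idealMr.
  by apply: idealMl; [have [] := MP Q' (or_intror Q'M) | exact: yM].
exists (x + y); first exact: idealD.
split=> [Pxy|Q QL' Qxy].
  by apply: Py; rewrite -(addKr x y) addrC; apply: idealB.
apply: (xL' Q QL'); rewrite -(addrK y x); apply: idealB => //; last exact: yL'.
by have [/(fun QL => LP Q (or_intror QL)) [[]]] := (L'E Q).1 QL'.
Qed.

End CommutativeAlgebra.

(** * Koszul homology of three elements *)

Section Koszul.
Local Open Scope ring_scope.
Local Open Scope classical_set_scope.

Variables (A : comNzRingType) (x y z : A).
Implicit Types (J : set A) (f : A).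

(* [koszulN J] is the vanishing of the N-th Koszul homology of [(x, y, z)] on
   [A / J]; with [v = (x, y, z)] the three differentials are [e |-> e v],
   [w |-> w \times v] and [u |-> u . v]. *)
Definition koszul1 J := forall u1 u2 u3, J (u1 * x + u2 * y + u3 * z) ->
  exists w1 w2 w3, [/\ J (u1 - (w2 * z - w3 * y)), J (u2 - (w3 * x - w1 * z))
                     & J (u3 - (w1 * y - w2 * x))].

Definition koszul2 J := forall w1 w2 w3, J (w2 * z - w3 * y) ->
  J (w3 * x - w1 * z) -> J (w1 * y - w2 * x) ->
  exists e, [/\ J (w1 - e * x), J (w2 - e * y) & J (w3 - e * z)].

Definition koszul3 J := forall e, J (e * x) -> J (e * y) -> J (e * z) -> J e.

Section Step.
Variables (J : set A) (f : A).
Hypothesis idJ : is_ideal J.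
Hypothesis f_regular : forall a, J (a * f) -> J a.
Hypothesis f_radical : radical (ideal_gen [:: x; y; z]) f.

(** A power of [f] is a combination of [x], [y], [z], so it kills [e] modulo [J]; being regular, [f]
    cancels. *)
Lemma koszul3_regular : koszul3 J.
Proof.
move=> e ex ey ez; have [k /ideal_gen3 [p [q [r fk]]]] := f_radical.
have : J (e * f ^+ k).
  rewrite fk (_ : _ * _ = p * (e * x) + q * (e * y) + r * (e * z)); last by ring.
  by apply: idealD => //; [apply: idealD|] => //; exact: idealMl.
elim: {fk} k => [|k IHk]; first by rewrite expr0 mulr1.
by rewrite exprSr mulrA => /f_regular.
Qed.

(* The long exact sequence of [0 -> A/J -f-> A/J -> A/(J + f) -> 0] makes [f]
   injective on the homology below, which is killed by a power of [f]. *)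
Lemma koszul2_regular : koszul3 (ideal_adjoin J f) -> koszul2 J.
Proof.
move=> K3 w1 w2 w3 c1 c2 c3; have [k /ideal_gen3 [p [q [r fk]]]] := f_radical.
have : exists e, [/\ J (f ^+ k * w1 - e * x), J (f ^+ k * w2 - e * y)
    & J (f ^+ k * w3 - e * z)].
  (* Contraction with the coefficients [(p, q, r)] is a homotopy for multiplication by [f ^+ k]. *)
  exists (p * w1 + q * w2 + r * w3); rewrite fk.
  split; [
    rewrite (_ : _ - _ = q * (w1 * y - w2 * x) - r * (w3 * x - w1 * z)) |
    rewrite (_ : _ - _ = r * (w2 * z - w3 * y) - p * (w1 * y - w2 * x)) |
    rewrite (_ : _ - _ = p * (w3 * x - w1 * z) - q * (w2 * z - w3 * y)) ];
    by [ring | apply: idealB => //; exact: idealMl].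
elim: {fk} k => [|k IHk]; first by rewrite expr0 !mul1r.
rewrite exprS => -[e [e1 e2 e3]]; apply: IHk.
have [||| e' Je'] := K3 e.
- exists (f ^+ k * w1).
  rewrite (_ : _ - _ = - (f * f ^+ k * w1 - e * x)); last by ring.
  exact: idealN.
- exists (f ^+ k * w2).
  rewrite (_ : _ - _ = - (f * f ^+ k * w2 - e * y)); last by ring.
  exact: idealN.
- exists (f ^+ k * w3).
  rewrite (_ : _ - _ = - (f * f ^+ k * w3 - e * z)); last by ring.
  exact: idealN.
exists e'; split; apply: f_regular;
  [rewrite (_ : _ * f = (f * f ^+ k * w1 - e * x) + x * (e - e' * f)) |
   rewrite (_ : _ * f = (f * f ^+ k * w2 - e * y) + y * (e - e' * f)) |
   rewrite (_ : _ * f = (f * f ^+ k * w3 - e * z) + z * (e - e' * f)) ];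
  by [ring | apply: idealD => //; exact: idealMl].
Qed.

(** The argument of [koszul2_regular] one degree lower, with the cross product by [(p, q, r)] as
    homotopy. *)
Lemma koszul1_regular : koszul2 (ideal_adjoin J f) -> koszul1 J.
Proof.
move=> K2 u1 u2 u3 cu; have [k /ideal_gen3 [p [q [r fk]]]] := f_radical.
have : exists w1 w2 w3, [/\ J (f ^+ k * u1 - (w2 * z - w3 * y)),
    J (f ^+ k * u2 - (w3 * x - w1 * z)) & J (f ^+ k * u3 - (w1 * y - w2 * x))].
  exists (q * u3 - r * u2), (r * u1 - p * u3), (p * u2 - q * u1); rewrite fk.
  split;
    [rewrite (_ : _ - _ = p * (u1 * x + u2 * y + u3 * z)) |
     rewrite (_ : _ - _ = q * (u1 * x + u2 * y + u3 * z)) |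
     rewrite (_ : _ - _ = r * (u1 * x + u2 * y + u3 * z)) ];
    by [ring | exact: idealMl].
elim: {fk} k => [|k IHk]; first by rewrite expr0 !mul1r.
rewrite exprS => -[w1 [w2 [w3 [e1 e2 e3]]]]; apply: IHk.
have [||| e [[w1' Jw1] [w2' Jw2] [w3' Jw3]]] := K2 w1 w2 w3.
- exists (f ^+ k * u1).
  rewrite (_ : _ - _ = - (f * f ^+ k * u1 - (w2 * z - w3 * y))); last by ring.
  exact: idealN.
- exists (f ^+ k * u2).
  rewrite (_ : _ - _ = - (f * f ^+ k * u2 - (w3 * x - w1 * z))); last by ring.
  exact: idealN.
- exists (f ^+ k * u3).
  rewrite (_ : _ - _ = - (f * f ^+ k * u3 - (w1 * y - w2 * x))); last by ring.
  exact: idealN.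
exists w1', w2', w3'; split; apply: f_regular;
  [rewrite (_ : _ * f = (f * f ^+ k * u1 - (w2 * z - w3 * y))
      + (z * (w2 - e * y - w2' * f) - y * (w3 - e * z - w3' * f))) |
   rewrite (_ : _ * f = (f * f ^+ k * u2 - (w3 * x - w1 * z))
      + (x * (w3 - e * z - w3' * f) - z * (w1 - e * x - w1' * f))) |
   rewrite (_ : _ * f = (f * f ^+ k * u3 - (w1 * y - w2 * x))
      + (y * (w1 - e * x - w1' * f) - x * (w2 - e * y - w2' * f))) ];
  by [ring | apply: idealD => //; apply: idealB => //; exact: idealMl].
Qed.

End Step.

(** Each regular element shifts the vanishing by one degree: degree 3 modulo [(f1, f2)], degree 2
    modulo [f1], degree 1 over [A]. *)
Lemma koszul1_regular_seq f1 f2 f3 : regular_seq [:: f1; f2; f3] ->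
  {in [:: f1; f2; f3], forall f, radical (ideal_gen [:: x; y; z]) f} ->
  koszul1 [set 0].
Proof.
move=> [reg _] rad; rewrite -ideal_gen_nil.
have id0 := ideal_gen_is_ideal (@nil A).
apply: (@koszul1_regular _ f1) => //.
- exact: (reg 0%N).
- by apply: rad; rewrite !inE eqxx.
rewrite -ideal_gen_cons; apply: (@koszul2_regular _ f2).
- exact: ideal_gen_is_ideal.
- exact: (reg 1%N).
- by apply: rad; rewrite !inE eqxx orbT.
rewrite -ideal_gen_cons; apply: (@koszul3_regular _ f3).
- exact: ideal_gen_is_ideal.
- have swap a : ideal_gen [:: f2; f1] a <-> ideal_gen [:: f1; f2] a.
    by rewrite !ideal_gen2; split=> -[b [c ->]]; exists c, b; rewrite addrC.
  by move=> a /swap /(reg 2%N isT) /swap.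
- by apply: rad; rewrite !inE eqxx !orbT.
Qed.

(** * Regularity from the vanishing of first Koszul homology *)

Variable m : set A.
Hypotheses (noethA : noetherian A) (local_m : local_ring m).
Hypotheses (mx : m x) (my : m y) (mz : m z).

(** For [c * y = d * x], exactness at [(- d, c, 0)] gives [c = w3 * x - w1 * z] with [w1] again in
    [C], so [C] lies in [m C + (x)]. *)
Lemma koszul1_regular2 : koszul1 [set 0] ->
  forall a b, a * y = b * x -> exists c, a = c * x.
Proof.
move=> K1 a b ay; apply/ideal_gen1.
pose C := colon_ideal (ideal_gen [:: x]) y.
suff CK : C `<=` ideal_gen [:: x] by apply: CK; apply/ideal_gen1; exists b.
apply: (nakayama noethA local_m); [|exact: ideal_gen_is_ideal|].
  by apply: colon_is_ideal; exact: ideal_gen_is_ideal.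
move=> c /ideal_gen1 [d cy].
have [|w1 [w2 [w3 [/= _ /eqP e2 /eqP e3]]]] := K1 (- d) c 0.
  by rewrite /= cy; ring.
exists (z * - w1).
  exists [:: (z, - w1)]; last by rewrite big_seq1.
  move=> p; rewrite inE => /eqP -> /=; split=> //.
  apply/ideal_gen1; exists (- w2); apply/eqP; rewrite -subr_eq0 -(eqP e3).
  by apply/eqP; ring.
apply/ideal_gen1; exists w3; apply/eqP; rewrite -subr_eq0 -[X in _ == X](eqP e2).
by apply/eqP; ring.
Qed.

(** Exactness at [(c, 0, 0)] gives [w]. Subtracting a multiple of [(x, y, z)] makes [w1 = 0]; then
    [w2] and [w3] annihilate [x], and [c = w2 * z - w3 * y] lies in [m C]. *)
Lemma koszul1_regular1 : koszul1 [set 0] -> forall a, a * x = 0 -> a = 0.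
Proof.
move=> K1 a ax.
pose C := colon_ideal [set 0] x.
have id0 : is_ideal [set (0 : A)]
  by rewrite -ideal_gen_nil; exact: ideal_gen_is_ideal.
suff CK : C `<=` [set 0] by apply: CK.
apply: (nakayama noethA local_m) => //; first exact: colon_is_ideal.
move=> c /= cx.
have [|w1 [w2 [w3 [/= /eqP e1 /eqP e2 /eqP e3]]]] := K1 c 0 0.
  by rewrite /= cx; ring.
have {e2} e2 : w3 * x = w1 * z
  by apply/eqP; rewrite -subr_eq0 -oppr_eq0 -(eqP e2) sub0r.
have {e3} e3 : w1 * y = w2 * x
  by apply/eqP; rewrite -subr_eq0 -oppr_eq0 -(eqP e3) sub0r.
have [t w1t] := koszul1_regular2 K1 e3.
exists (z * (w2 - t * y) + y * - (w3 - t * z)).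
  exists [:: (z, w2 - t * y); (y, - (w3 - t * z))]; last first.
    by rewrite big_cons big_seq1.
  move=> p; rewrite !inE => /orP [] /eqP -> /=; split=> //;
    rewrite /C /colon_ideal /=.
    by rewrite mulrBl -e3 w1t; ring.
  by rewrite mulNr mulrBl e2 w1t; ring.
by rewrite /= -(eqP e1); ring.
Qed.

Lemma koszul1_regular3 : koszul1 [set 0] ->
  forall a b c, a * z = b * x + c * y -> exists d e, a = d * x + e * y.
Proof.
move=> K1 a b c az; have [|w1 [w2 [w3 [_ _ /= /eqP e3]]]] := K1 (- b) (- c) a.
  by rewrite /= az; ring.
by exists (- w2), w1; apply/eqP; rewrite -subr_eq0 -(eqP e3); apply/eqP; ring.
Qed.

End Koszul.

(** * Systems of parameters *)

Section SystemsOfParameters.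
Local Open Scope ring_scope.
Local Open Scope classical_set_scope.

Variable A : comNzRingType.
Implicit Types (I P Q m : set A) (C : nat -> set A).

Lemma prime_chain_extend k C P :
  prime_chain k C -> prime_ideal P -> C k `<` P ->
  prime_chain k.+1 (fun i => if (i <= k)%N then C i else P).
Proof.
move=> [prC ltC] prP CP; split=> i ik; first by case: ifP => // /prC.
rewrite -ltnS ik; have [ik'|ki|->] := ltngtP i k; [exact: ltC| |exact: CP].
by move: ik; rewrite ltnS leqNgt ki.
Qed.

Lemma krull_dim_unique d e : krull_dim A d -> krull_dim A e -> d = e.
Proof.
move=> [[C chainC] dimd] [[D chainD] dime]; apply/eqP; rewrite eqn_leq.
by rewrite (dime _ _ chainC) (dimd _ _ chainD).
Qed.

Variable m : set A.
Hypotheses (noethA : noetherian A) (local_m : local_ring m).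

Lemma prime_sub_local P : prime_ideal P -> P `<=` m.
Proof.
move=> [idP P1 _] a Pa; apply: contrapT => ma; apply: P1.
by have [b <-] := local_unit noethA local_m ma; apply: idealMl.
Qed.

Lemma max_sub_prime P : prime_ideal P -> m `<=` P -> P = m.
Proof. by move=> [idP P1 _] mP; case: local_m => -[_ _ maxm] _; exact: maxm. Qed.

(* Each new parameter avoids the finitely many primes other than [m] that
   dominate the primes over the previous ones, so that the primes over the
   first [i] parameters either equal [m] or end a chain of length [i]. *)
Lemma system_of_parameters_in I d :
  krull_dim A d -> is_ideal I -> radical I = m ->
  exists s, [/\ size s = d, {in s, forall x, I x}
              & radical (ideal_gen s) = m].
Proof.
move=> [_ dimA] idI radI.
have Im : I `<=` m by move=> a Ia; rewrite -radI; exists 1%N.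
have prm : prime_ideal m by apply: maximal_ideal_prime; case: local_m.
have radI_prime P : prime_ideal P -> I `<=` P -> m `<=` P.
  move=> prP IP a; rewrite -radI => -[k /IP]; exact: prime_idealX.
have [s [sz_s sI chain_s]] : exists s, [/\ size s = d, {in s, forall x, I x} &
    forall P, prime_ideal P -> ideal_gen s `<=` P ->
    P = m \/ exists2 C, prime_chain d C & C d = P].
  elim: (d) => [|i [s [sz_s sI chain_s]]].
    by exists [::]; split=> // P prP _; right; exists (fun=> P) => //.
  have [L [LP domL]] := primes_over_finite noethA (ideal_gen_is_ideal s).
  pose L' := [seq Q <- L | `[< Q <> m >]].
  have L'E Q : List.In Q L' <-> List.In Q L /\ Q <> m.
    by rewrite /L' List.filter_In; split=> -[QL /asboolP Qm].
  have [Q /L'E [QL Qm]|x Ix xL'] := @prime_avoidance _ I L' idI.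
    have [prQ _] := LP Q QL; split=> // IQ; apply: Qm.
    by apply: max_sub_prime => //; exact: radI_prime.
  exists (x :: s); split=> [|y|P prP sP]; first by rewrite /= sz_s.
    by rewrite inE => /predU1P [->|/sI].
  have idP : is_ideal P by case: prP.
  have Px : P x by apply/sP/mem_ideal_gen; rewrite mem_head.
  have {}sP : ideal_gen s `<=` P.
    by apply: ideal_gen_sub => // y ys; apply/sP/mem_ideal_gen; rewrite inE ys orbT.
  have [Q QL QP] := domL P prP sP; have [prQ sQ] := LP Q QL.
  have [Qm|Qm] := pselect (Q = m).
    by left; apply: max_sub_prime => //; rewrite -Qm.
  have Qx : ~ Q x by apply/xL'/L'E.
  have [//|[C chainC CQ]] := chain_s Q prQ sQ; right.
  exists (fun j => if (j <= i)%N then C j else P); last by rewrite ltnn.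
  by apply: prime_chain_extend => //; rewrite CQ; split=> // /(_ x Px).
exists s; split=> //; apply/seteqP; split=> [a [k] /(ideal_gen_sub idI sI) /Im|a ma].
  exact: prime_idealX.
apply: (radical_prime noethA) => [|P prP sP]; first exact: ideal_gen_is_ideal.
have [->//|[C chainC CP]] := chain_s P prP sP.
(* A prime other than [m] over all [d] parameters would end a chain of length [d], which [m] would
   prolong. *)
apply: contrapT => Pa; suff : (d.+1 <= d)%N by rewrite ltnn.
apply: dimA; apply: (prime_chain_extend chainC prm).
rewrite CP; split; first exact: prime_sub_local.
by move=> /(_ a ma).
Qed.

End SystemsOfParameters.

(** * Invariants of an involution *)

Section Involution.
Local Open Scope ring_scope.
Local Open Scope classical_set_scope.

Variables (R : comNzRingType) (gT : finGroupType) (to : ring_action gT R).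
Hypothesis card_G : #|gT| = 2%N.
Variable g : gT.
Hypothesis g1 : g != 1%g.
Notation s := (to^~ g).
Notation A := (fixring to).
Implicit Types (a b r u w : R) (P Q : set R) (p q : set A).

Lemma order2_elem h : h = 1%g \/ h = g.
Proof.
have /setP /(_ h) : [set 1%g; g]%SET = [set: gT]%SET.
  by apply/eqP; rewrite eqEcard finset.subsetT cardsT card_G cards2 eq_sym g1.
by rewrite !inE => /orP [] /eqP ->; [left | right].
Qed.

Lemma ring_act1 a : to a 1%g = a.
Proof.
have inj1 : injective (to^~ 1%g).
  by case: (ring_act to) => f [inj_f fM] x y; exact: inj_f.
by apply: inj1; rewrite -ring_actM mulg1.
Qed.

Lemma invB a b : s (a - b) = s a - s b. Proof. exact: ring_act_zmod. Qed.

Lemma inv0 : s 0 = 0. Proof. by have := invB 0 0; rewrite !subrr. Qed.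

Lemma invN a : s (- a) = - s a. Proof. by rewrite -sub0r invB inv0 sub0r. Qed.

Lemma invD a b : s (a + b) = s a + s b.
Proof. by rewrite -{1}(opprK b) invB invN opprK. Qed.

Lemma invM a b : s (a * b) = s a * s b.
Proof. by have [_ ->] := ring_act_monoid to g. Qed.

Lemma inv1 : s 1 = 1. Proof. by have [] := ring_act_monoid to g. Qed.

Lemma invK a : s (s a) = a.
Proof.
have gg : (g * g)%g = 1%g.
  have [//|ggg] := order2_elem (g * g)%g.
  by case/eqP: g1; apply: (mulgI g); rewrite ggg mulg1.
by rewrite -ring_actM gg ring_act1.
Qed.

Lemma inv_fixval (c : A) : s (fixval c) = fixval c.
Proof. by have /fixedP := fixvalP c. Qed.

Lemma fixringP a : s a = a -> exists c : A, fixval c = a.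
Proof.
move=> sa; suff fa : a \in fixed to by exists (Fixring fa).
by apply/fixedP => h; have [->|->] := order2_elem h; rewrite ?ring_act1.
Qed.

Lemma fixval_inj : injective (@fixval gT R to). Proof. exact: val_inj. Qed.
Lemma fixvalD (c d : A) : fixval (c + d) = fixval c + fixval d. Proof. by []. Qed.
Lemma fixvalN (c : A) : fixval (- c) = - fixval c. Proof. by []. Qed.
Lemma fixvalM (c d : A) : fixval (c * d) = fixval c * fixval d. Proof. by []. Qed.
Lemma transferE a : fixval (transfer to a) = a + s a.
Proof.
rewrite /= (bigD1 1%g) //= ring_act1 (bigD1 g) //= big1 ?addr0 //.
move=> h /andP [h1 hg].
by have [hE|hE] := order2_elem h; rewrite hE eqxx in h1 hg.
Qed.

Lemma norm_fixed a : a * s a \in fixed to.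
Proof.
by apply/fixedP => h; have [->|->] := order2_elem h;
  rewrite ?ring_act1 // invM invK mulrC.
Qed.

(** With the transfer it gives [a ^+ 2 - tr a * a + norm a = 0], the integrality of [R] over [A]. *)
Definition norm a : A := Fixring (norm_fixed a).

(** * Primes of [R] and of the invariants *)

Definition contraction P : set A := [set c | P (fixval c)].

Lemma contractionE P (c : A) : contraction P c = P (fixval c). Proof. by []. Qed.

Lemma contraction_is_ideal P : is_ideal P -> is_ideal (contraction P).
Proof.
move=> idP; split=> [|c d|c d]; rewrite /contraction /=.
- exact: ideal0.
- exact: idealD.
- exact: idealMl.
Qed.

Lemma contraction_prime P : prime_ideal P -> prime_ideal (contraction P).
Proof.
move=> [idP P1 PM]; split=> [||c d]; [exact: contraction_is_ideal | exact: P1 |].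
exact: PM.
Qed.

(** For [a] in [Q] the norm lies in [P], so [a] or [s a] does; in the second case [a] follows, as
    [a + s a] is in [P] too. *)
Lemma contraction_incomparable P Q : prime_ideal P -> prime_ideal Q ->
  P `<=` Q -> contraction Q `<=` contraction P -> Q `<=` P.
Proof.
move=> [idP _ PM] [idQ _ _] PQ QP a Qa.
have [//|Psa] : P a \/ P (s a).
  by apply: PM; apply: (QP (norm a)); exact: idealMr.
have Qtr : Q (fixval (transfer to a)).
  by rewrite transferE; apply: idealD => //; exact: PQ.
have Ptr : P (a + s a) by rewrite -transferE; exact: QP Qtr.
by rewrite -(addrK (s a) a); exact: idealB.
Qed.

Lemma contraction_proper P Q : prime_ideal P -> prime_ideal Q ->
  P `<` Q -> contraction P `<` contraction Q.
Proof.
move=> prP prQ [PQ QP]; split=> [c /PQ //|QP']; apply: QP.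
exact: contraction_incomparable.
Qed.

(* Not the ideal generated by [q], but a larger one that still lies over [q]
   and is described without sums. *)
Definition extension q : set R :=
  [set w | (forall r, q (transfer to (r * w))) /\ q (norm w)].

Lemma extension_is_ideal q : is_ideal q -> is_ideal (extension q).
Proof.
move=> idq; split.
- split=> [r|].
    rewrite (_ : transfer to _ = 0); first exact: ideal0.
    by apply: fixval_inj; rewrite transferE mulr0 inv0 addr0.
  rewrite (_ : norm _ = 0); first exact: ideal0.
  by apply: fixval_inj; rewrite /= mul0r.
- move=> a b [Ta Na] [Tb Nb]; split=> [r|].
    rewrite (_ : transfer to _ = transfer to (r * a) + transfer to (r * b)).
      exact: idealD.
    by apply: fixval_inj; rewrite fixvalD !transferE mulrDr invD; ring.
  (* The cross term falls under the transfer condition on [a], with [r = s b]. *)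
  rewrite (_ : norm _ = norm a + norm b + transfer to (s b * a)).
    by apply: idealD => //; exact: idealD.
  by apply: fixval_inj; rewrite !fixvalD transferE /= invD invM invK; ring.
- move=> a b [Tb Nb]; split=> [r|]; first by rewrite mulrA.
  rewrite (_ : norm _ = norm a * norm b); first exact: idealMl.
  by apply: fixval_inj; rewrite fixvalM /= invM; ring.
Qed.

Lemma sub_extension q c : is_ideal q -> q c -> extension q (fixval c).
Proof.
move=> idq qc; split=> [r|].
  rewrite (_ : transfer to _ = transfer to r * c); first exact: idealMl.
  by apply: fixval_inj; rewrite fixvalM !transferE invM inv_fixval; ring.
rewrite (_ : norm _ = c * c); first exact: idealMl.
by apply: fixval_inj; rewrite fixvalM /= inv_fixval.
Qed.

(** [Q] contains [P] and [extension q] and avoids the invariants outside [q]. Any ideal [P] is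
    allowed, which lets [lying_over] start from zero. *)
Lemma going_up (P : set R) q : noetherian R -> is_ideal P -> prime_ideal q ->
  contraction P `<=` q ->
  exists Q, [/\ prime_ideal Q, P `<=` Q & contraction Q = q].
Proof.
move=> noethR idP prq Pq; have [idq q1 qM] := prq.
pose I : set R := [set a | exists2 w, extension q w & P (a - w)].
have idE := extension_is_ideal idq.
have idI : is_ideal I.
  split.
  - by exists 0; [exact: ideal0 | rewrite subr0; exact: ideal0].
  - move=> a b [v Ev Pa] [w Ew Pb]; exists (v + w); first exact: idealD.
    by rewrite opprD addrACA; exact: idealD.
  - move=> a b [w Ew Pb]; exists (a * w); first exact: idealMl.
    by rewrite -mulrBr; exact: idealMl.
have [||a [c qc <-] [w [Tw Nw] Pu]|Q [prQ IQ SQ]] := @prime_avoiding R noethR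
  [set fixval c | c in ~` q] I _ _ idI.
- by exists 1.
- by move=> _ _ [c qc <-] [d qd <-]; exists (c * d) => //= /qM [].
(* If [c] is congruent to [w] modulo [P], then [norm (c - w) = c ^+ 2 - tr w * c + norm w] lies in
   [contraction P], hence in [q], and so does [c ^+ 2]. *)
- apply: qc; have : q (c ^+ 2); last exact: prime_idealX.
  rewrite (_ : _ ^+ 2 =
    c * transfer to (1 * w) - norm w + norm (fixval c - w)).
    apply: idealD => //; last by apply: Pq; exact: idealMr.
    by apply: idealB => //; exact: idealMl.
  apply: fixval_inj; rewrite expr2 !fixvalD fixvalN !fixvalM transferE /=.
  by rewrite mul1r invB inv_fixval; ring.
exists Q; split=> //.
  by move=> a Pa; apply: IQ; exists 0; [exact: ideal0 | rewrite subr0].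
apply/seteqP; split=> [c Qc|c qc].
  by apply: contrapT => qc; apply: (SQ (fixval c)) => //; exists c.
apply: IQ; exists (fixval c); first exact: sub_extension.
by rewrite subrr; exact: ideal0.
Qed.

Lemma lying_over q : noetherian R -> prime_ideal q ->
  exists2 Q, prime_ideal Q & contraction Q = q.
Proof.
move=> noethR prq; have [idq _ _] := prq.
have [||Q [prQ _ Qq]] := @going_up [set 0] q noethR _ prq.
- by rewrite -ideal_gen_nil; exact: ideal_gen_is_ideal.
- by move=> c c0; rewrite (_ : c = 0); [exact: ideal0 | exact: fixval_inj].
by exists Q.
Qed.

(** Chains of [R] stay strict under contraction by incomparability; chains of [A] lift step by step
    by going up. *)
Lemma krull_dim_fixring d : noetherian R -> krull_dim R d -> krull_dim A d.
Proof.
move=> noethR [[C [prC ltC]] dimR]; split.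
  exists (fun i => contraction (C i)); split=> i id.
    by apply: contraction_prime; exact: prC.
  by apply: contraction_proper; [apply: prC; exact: ltnW | exact: prC | exact: ltC].
move=> k D [prD ltD].
suff [E chainE _] : exists2 E, prime_chain k E & contraction (E k) = D k.
  exact: dimR chainE.
elim: k prD ltD => [|k IHk] prD ltD.
  have [Q prQ QD] := lying_over noethR (prD 0%N isT).
  by exists (fun=> Q).
have [||E chainE Ek] := IHk; first by move=> i ik; apply: prD; exact: ltnW.
  by move=> i ik; apply: ltD; exact: ltnW.
have [[prE _] [Dk Dk']] := (chainE, ltD k (ltnSn k)).
have [|||Q [prQ EQ Qk]] := @going_up (E k) (D k.+1) noethR.
- by have [] := prE k (leqnn k).
- exact: prD.
- by rewrite Ek.
exists (fun i => if (i <= k)%N then E i else Q); last by rewrite ltnn.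
apply: prime_chain_extend => //; split=> // QE; apply: Dk'.
by rewrite -Qk -Ek => c /QE.
Qed.

(** * The local ring of invariants *)

Variable m : set R.
Hypotheses (noethR : noetherian R) (local_m : local_ring m).

Lemma proper_sub_contraction (I : set A) :
  is_ideal I -> ~ I 1 -> I `<=` contraction m.
Proof.
move=> idI I1 a Ia; apply: contrapT => ma; apply: I1.
have [b ba1] := local_unit noethR local_m ma.
(* The inverse is invariant: [s b = s b * (b * a) = b * s (b * a) = b]. *)
have [c cb] : exists c : A, fixval c = b.
  by apply: fixringP; rewrite -[LHS]mulr1 -[in LHS]ba1 mulrCA
    -[X in _ * (_ * X)](inv_fixval a) -invM ba1 inv1 mulr1.
rewrite (_ : 1 = c * a); first exact: idealMl.
by apply: fixval_inj; rewrite fixvalM cb ba1.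
Qed.

Lemma maximal_fixring n : maximal_ideal n -> n = contraction m.
Proof.
move=> [idn n1 maxn]; have [[idm m1 _] _] := local_m; apply/esym/maxn => //.
  exact: contraction_is_ideal.
exact: proper_sub_contraction.
Qed.

Lemma fixring_local : local_ring (contraction m).
Proof.
have [[idm m1 _] _] := local_m.
split=> [|n max_n]; last exact: maximal_fixring.
split=> // [|I idI I1 mI]; first exact: contraction_is_ideal.
by apply/seteqP; split=> //; exact: proper_sub_contraction.
Qed.

(** * Wild actions in characteristic 2 *)

Hypothesis char_R : 2%N \in [pchar R].
Hypothesis wild : acts_wildly to m.

Lemma inv_char2P a : a + s a = 0 <-> s a = a.
Proof.
split=> [/eqP|->]; last by rewrite (addrr_pchar2 char_R).
by rewrite addr_eq0 (oppr_pchar2 char_R) => /eqP.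
Qed.

Lemma transfer_in_m a : contraction m (transfer to a).
Proof.
have [[idm _ _] _] := local_m; have [triv _ _ _] := wild.
have mt : m (s a - a) by have : inertia to m g by rewrite triv.
by rewrite contractionE transferE addrC -[X in _ + X](oppr_pchar2 char_R).
Qed.

Lemma range_transfer_is_ideal : is_ideal (range (transfer to)).
Proof.
split=> [|_ _ [a _ <-] [b _ <-]|c _ [a _ <-]].
- by exists 0 => //; apply: fixval_inj; rewrite transferE inv0 addr0.
- by exists (a + b) => //; apply: fixval_inj; rewrite fixvalD !transferE invD; ring.
- exists (fixval c * a) => //; apply: fixval_inj.
  by rewrite fixvalM !transferE invM inv_fixval; ring.
Qed.

(* A prime of [A] containing the image of the transfer lies under a prime of
   [R] with non-trivial inertia. *)
Lemma radical_transfer : radical (range (transfer to)) = contraction m.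
Proof.
have [_ free noethA _] := wild.
have [max_m _] := fixring_local.
apply/seteqP; split=> [c [k [a _ ck]]|c mc].
  apply: (prime_idealX (maximal_ideal_prime max_m)) (_ : contraction m (c ^+ k)).
  by rewrite -ck; exact: transfer_in_m.
apply: (radical_prime noethA) => [|q prq trq]; first exact: range_transfer_is_ideal.
have [Q prQ Qq] := lying_over noethR prq; rewrite -Qq.
have [->//|Qm] := pselect (Q = m).
have Qg : ~ inertia to Q g by rewrite free // => g_eq1; case/eqP: g1.
exfalso; apply: Qg => a.
have : Q (fixval (transfer to a)) by rewrite -contractionE Qq; apply: trq.
by rewrite transferE addrC (oppr_pchar2 char_R).
Qed.

(** * The two implications over a Cohen-Macaulay ring of dimension 3 *)

Hypotheses (CM_R : cohen_macaulay m) (dim_R : krull_dim R 3).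

Lemma maximal_regular_seq : exists f1 f2 f3,
  regular_seq [:: f1; f2; f3] /\ {in [:: f1; f2; f3], forall f, m f}.
Proof.
have [_ [d [dim_d [[t [sz_t tm reg_t]] _]]]] := CM_R.
have /= := krull_dim_unique dim_d dim_R; rewrite -sz_t.
by case: t tm reg_t {sz_t} => [|f1 [|f2 [|f3 [|]]]] // tm reg _; exists f1, f2, f3.
Qed.

(** A prime of [R] over [(x, y, z)] contains every invariant in [m]. For [f] in [m] it thus contains
    [f ^+ 2 = tr f * f - norm f], so the regular sequence of [R] lies in the radical of
    [(x, y, z)]. *)
Lemma parameters_koszul (x y z : A) :
  radical (ideal_gen [:: x; y; z]) = contraction m ->
  koszul1 (fixval x) (fixval y) (fixval z) [set 0].
Proof.
move=> rad; have [f1 [f2 [f3 [reg fm]]]] := maximal_regular_seq.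
have [[idm _ _] _] := local_m.
apply: koszul1_regular_seq reg _ => f /fm mf.
apply: (radical_prime noethR) => [|P prP genP]; first exact: ideal_gen_is_ideal.
have idP : is_ideal P by case: prP.
have mP (c : A) : m (fixval c) -> P (fixval c).
  move=> mc; have : contraction m c by [].
  rewrite -rad => -[k ck].
  apply: (@prime_idealX _ (contraction P) c k); first exact: contraction_prime.
  move: ck; apply: ideal_gen_sub; first exact: contraction_is_ideal.
  move=> w; rewrite !inE contractionE => /or3P [] /eqP ->;
    by apply/genP/mem_ideal_gen; rewrite !inE eqxx ?orbT.
apply: (prime_idealX (k := 2) prP).
have -> : f ^+ 2 = (f + s f) * f - f * s f by ring.
apply: idealB => //.
  by apply: idealMr => //; rewrite -transferE; apply: mP; exact: transfer_in_m.
by apply: (mP (norm f)); exact: idealMr.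
Qed.

Lemma transfer_buchsbaum :
  range (transfer to) = contraction m -> buchsbaum (contraction m).
Proof.
move=> trm; have [_ _ noethA _] := wild.
split=> [|t [dim_t tm rad_t]]; first by split=> //; exact: fixring_local.
have := krull_dim_unique dim_t (krull_dim_fixring noethR dim_R).
case: t dim_t tm rad_t => [|x [|y [|z [|]]]] //= _ tm rad _.
have mx : m (fixval x) by apply: tm; rewrite !inE eqxx.
have my : m (fixval y) by apply: tm; rewrite !inE eqxx orbT.
have mz : m (fixval z) by apply: tm; rewrite !inE eqxx !orbT.
have K1 := parameters_koszul rad.
have reg1 := koszul1_regular1 noethR local_m my mz K1.
have reg2 := koszul1_regular2 noethR local_m mz K1.
have reg3 := koszul1_regular3 K1.
split=> // i i3 _ [l lP ->]; rewrite big_seq; apply: ideal_sum => [|[c a] /lP /=].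
  exact: ideal_gen_is_ideal.
rewrite /colon_ideal -trm => {lP} -[[w _ cw]].
(* For [i < 2] the quotients found in [R] are invariant, by cancellation of [x]; the preimage [w] of
   [c] enters at [i = 2]. *)
case: i i3 => [|[|[|//]]] _ /=.
- rewrite ideal_gen_nil => /= /(congr1 (@fixval gT R to));
  rewrite fixvalM => /reg1 a0.
  by apply: fixval_inj; rewrite fixvalM a0 mulr0.
- case/ideal_gen1 => b /(congr1 (@fixval gT R to)); rewrite !fixvalM => ayE.
  have [r ar] := reg2 _ _ ayE.
  have [r' r'E] : exists r' : A, fixval r' = r.
    apply: fixringP; apply/eqP; rewrite -subr_eq0; apply/eqP/reg1.
    by rewrite mulrBl -{1}(inv_fixval x) -invM -ar inv_fixval subrr.
  apply/ideal_gen1; exists (c * r'); apply: fixval_inj.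
  by rewrite !fixvalM r'E ar mulrA.
case/ideal_gen2 => b [b' /(congr1 (@fixval gT R to))];
rewrite fixvalD !fixvalM => azE.
have [r [u aE]] := reg3 _ _ _ azE.
(* The transfer of the invariant [a] vanishes, so [(tr r, tr u)] is a relation on [x], [y], hence of
   the form [(- v * y, v * x)]. *)
have tr0 : (r + s r) * fixval x + (u + s u) * fixval y = 0.
  transitivity (fixval a + s (fixval a)).
    by rewrite aE invD !invM !inv_fixval; ring.
  by apply/inv_char2P; exact: inv_fixval.
have [v uv] : exists v, u + s u = v * fixval x.
  by apply: (reg2 _ (- (r + s r))); apply/eqP; rewrite mulNr -addr_eq0 addrC tr0.
have rv : r + s r = - (v * fixval y).
  apply/eqP; rewrite -addr_eq0; apply/eqP/reg1.
  by rewrite -[RHS]tr0 uv; ring.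
have sv : s v = v.
  apply/inv_char2P/reg1; rewrite mulrDl.
  have -> : s v * fixval x = s (v * fixval x) by rewrite invM inv_fixval.
  by rewrite -uv; apply/inv_char2P; rewrite invD invK addrC.
have cE : fixval c = w + s w by rewrite -cw transferE.
(* Adding [v * w * (y, - x)] to [c * (r, u)] kills both transfers, because [tr w = c], and keeps the
   combination [c * a]. *)
have [d dE] : exists d : A, fixval d = fixval c * r + fixval y * v * w.
  apply: fixringP; apply/inv_char2P; rewrite invD !invM !inv_fixval sv.
  transitivity (fixval c * (r + s r) + v * fixval y * (w + s w)); first by ring.
  by rewrite rv -cE; ring.
have [e eE] : exists e : A, fixval e = fixval c * u - fixval x * v * w.
  apply: fixringP; apply/inv_char2P; rewrite invB !invM !inv_fixval sv.
  transitivity (fixval c * (u + s u) - v * fixval x * (w + s w)); first by ring.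
  by rewrite uv -cE; ring.
apply/ideal_gen2; exists d, e; apply: fixval_inj.
by rewrite fixvalD !fixvalM dE eE aE; ring.
Qed.

Lemma buchsbaum_transfer :
  buchsbaum (contraction m) -> range (transfer to) = contraction m.
Proof.
move=> [_ weak]; have [_ _ noethA _] := wild.
apply/seteqP; split=> [_ [a _ <-]|c mc]; first exact: transfer_in_m.
have dim_A := krull_dim_fixring noethR dim_R.
have [t [sz_t tI rad_t]] := system_of_parameters_in noethA fixring_local dim_A
  range_transfer_is_ideal radical_transfer.
have tm : {in t, forall x, contraction m x}.
  by move=> x /tI [a _ <-]; exact: transfer_in_m.
have : weak_sequence (contraction m) t by apply: weak; split=> //; rewrite sz_t.
case: t sz_t tI rad_t tm => [|x [|y [|z [|]]]] //= _ tI rad tm [_ /(_ 2%N isT) /=].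
have [[x' _ xE] [y' _ yE] [z' _ zE]] :
    [/\ range (transfer to) x, range (transfer to) y & range (transfer to) z].
  by split; apply: tI; rewrite !inE eqxx ?orbT.
have mx : m (fixval x) by apply: tm; rewrite !inE eqxx.
have my : m (fixval y) by apply: tm; rewrite !inE eqxx orbT.
have mz : m (fixval z) by apply: tm; rewrite !inE eqxx !orbT.
have K1 := parameters_koszul rad.
have reg1 := koszul1_regular1 noethR local_m my mz K1.
have reg2 := koszul1_regular2 noethR local_m mz K1.
have {}xE : fixval x = x' + s x' by rewrite -xE transferE.
have {}yE : fixval y = y' + s y' by rewrite -yE transferE.
have {}zE : fixval z = z' + s z' by rewrite -zE transferE.
(* The expression equals [u * s v - v * s u], which [s] negates; in characteristic 2 it is
   invariant. *)
have fixed_comb u v : exists d : A, fixval d = u * (v + s v) - v * (u + s u).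
  by apply: fixringP; apply/inv_char2P; rewrite invB !invM !invD !invK; ring.
have [a aE] := fixed_comb y' x'; have [d dE] := fixed_comb y' z'.
have [e eE] := fixed_comb z' x'.
(* [a], [d], [e] are the minors of the rows [(x', y', z')] and [(x, y, z)]; the relation expands a
   determinant with a repeated row. *)
have az : ideal_gen [:: x; y] (a * z).
  apply/ideal_gen2; exists d, e; apply: fixval_inj.
  by rewrite fixvalD !fixvalM aE dE eE xE yE zE; ring.
move=> nca; have : ideal_gen [:: x; y] (c * a).
  apply: nca; exists [:: (c, a)]; rewrite ?big_seq1 // => p.
  by rewrite inE => /eqP ->.
move=> /ideal_gen2 [r [u /(congr1 (@fixval gT R to))]];
rewrite fixvalD !fixvalM aE => caE.
have [|v uv] := reg2 (fixval u + fixval c * x') (fixval c * y' - fixval r).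
  apply: (addrI (fixval r * fixval x)); rewrite mulrDl addrA -caE xE yE; ring.
exists v => //; apply: fixval_inj; rewrite transferE.
(* The transfer of [v * x = u + c * x'] is [2 u + c * x = c * x], and [x] cancels. *)
apply/eqP; rewrite -subr_eq0; apply/eqP/reg1.
have -> : (v + s v - fixval c) * fixval x =
    v * fixval x + s (v * fixval x) - fixval c * fixval x.
  by rewrite invM inv_fixval; ring.
rewrite -uv invD invM !inv_fixval xE.
transitivity (fixval u + fixval u); first by ring.
exact: addrr_pchar2.
Qed.

End Involution.

Theorem corollary1p5 (R : comNzRingType) (m : set R)
  (CM_R : cohen_macaulay m) (dim_R : krull_dim R 3)
  (char_R : 2%N \in [pchar R]%R)
  (gT : finGroupType) (card_G : #|gT| = 2%N)
  (to : ring_action gT R) (wild : acts_wildly to m)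
  (n : set (fixring to)) (max_n : maximal_ideal n) :
  buchsbaum n <-> range (transfer to) = n.
Proof.
have [[noethR local_m] _] := CM_R.
have [g g1] : exists g : gT, g != 1%g.
  have := cardsD1 (1%g : gT) [set: gT]%SET; rewrite cardsT card_G finset.in_setT.
  move=> -[/esym /eqP /cards1P [g /setP /(_ g)]].
  by rewrite !inE eqxx andbT => g1; exists g.
rewrite (maximal_fixring card_G g1 noethR local_m max_n).
split; first exact: (buchsbaum_transfer card_G g1).
exact: (transfer_buchsbaum card_G g1).
Qed.
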